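(* Let $R=\mathbb{K}_1\times\cdots\times\mathbb{K}_s$ be a finite product of fields, and let $A(z)$ and $B(z)$ be matrices of sizes $p\times q_1$ and $p\times q_2$ respectively with entries in $R[z]$. Then there is an isomorphism of $R[z]$-modules $$\ker(A(z)\mid B(z))\cong\frac{\ker(\pi_1(A)(z),\pi_1(B)(z))}{\ker(\pi_1(A)(z))}\oplus\cdots\oplus\frac{\ker(\pi_s(A)(z),\pi_s(B)(z))}{\ker(\pi_s(A)(z))}.$$
   Context: For a commutative ring $T$ and matrices $A(z)\in T[z]^{p\times q_1}$, $B(z)\in T[z]^{p\times q_2}$, let $\ker(A(z)\mid B(z))=\{u(z)\in T[z]^{q_2}\mid\exists x(z)\in T[z]^{q_1}: A(z)x(z)+B(z)u(z)=0\}$, $\ker(A(z),B(z))=\{(x(z),u(z))\in T[z]^{q_1}\oplus T[z]^{q_2}\mid A(z)x(z)+B(z)u(z)=0\}$ and $\ker(A(z))=\{x(z)\in T[z]^{q_1}\mid A(z)x(z)=0\}$, the latter regarded as a submodule of $\ker(A(z),B(z))$ via $x(z)\mapsto(x(z),0)$. Here $\pi_i:R\to\mathbb{K}_i$ is the projection onto the $i$th factor and $\pi_i(A)(z)\in\mathbb{K}_i[z]^{p\times q_1}$ is the matrix obtained from $A(z)$ by applying $\pi_i$ to all coefficients of all entries (similarly for $B$). $\mathbb{K}_i[z]$-modules are regarded as $R[z]$-modules via the map $R[z]\to\mathbb{K}_i[z]$ induced by $\pi_i$. *)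

(* Defs.v *)
From HB Require Import structures.
From mathcomp Require Import all_boot all_order all_algebra.
From mathcomp Require Import boolp.

Set Implicit Arguments.
Unset Strict Implicit.
Unset Printing Implicit Defensive.

Import GRing.Theory.
Local Open Scope ring_scope.
Local Open Scope quotient_scope.

Section Submodule.
Variables (R : pzRingType) (V : lmodType R) (S : submodClosed V).

Record submodule := Submodule { submodule_val : V; _ : submodule_val \in S }.

HB.instance Definition _ := [isSub for submodule_val].
HB.instance Definition _ := [Choice of submodule by <:].
HB.instance Definition _ := [SubChoice_isSubLmodule of submodule by <:].

End Submodule.

Section QuotientModule.
Variables (R : pzRingType) (V : lmodType R) (S : submodClosed V).

(* S again: a submodClosed predicate is not canonically a zmodClosed one,
   which Quotient.quot requires. *)
Definition submod_pred : {pred V} := fun v => v \in S.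

Lemma submod_pred_zmod : zmod_closed submod_pred.
Proof. exact: GRing.submod_closedB (GRing.submodClosedP S). Qed.

HB.instance Definition _ :=
  GRing.isZmodClosed.Build V submod_pred submod_pred_zmod.

(* The library gives Quotient.quot the structure of an abelian group; the
   scaling is added on this alias. *)
Definition quotmod : Type := Quotient.quot submod_pred.

HB.instance Definition _ := GRing.Zmodule.on quotmod.

Definition quotmod_pi (v : V) : quotmod := \pi_(Quotient.quot submod_pred) v.

Definition quotmod_scale (a : R) (x : quotmod) : quotmod :=
  quotmod_pi (a *: repr (x : Quotient.quot submod_pred)).

Lemma quotmod_pi_eq (u v : V) :
  (quotmod_pi u == quotmod_pi v) = (u - v \in S).
Proof. by rewrite /quotmod_pi (Quotient.idealrBE submod_pred u v). Qed.

Lemma quotmod_piK (x : quotmod) : quotmod_pi (repr (x : Quotient.quot submod_pred)) = x.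
Proof. exact: reprK. Qed.

Lemma quotmod_piD : {morph quotmod_pi : u v / u + v}.
Proof. by move=> u v; exact: (@pi_addr _ _ _ _ _ (Quotient.quot submod_pred) u v). Qed.

Lemma quotmod_piZ a v : quotmod_pi (a *: v) = quotmod_scale a (quotmod_pi v).
Proof.
apply/eqP; rewrite quotmod_pi_eq -scalerBr rpredZ //.
by rewrite -quotmod_pi_eq quotmod_piK.
Qed.

Lemma quotmod_scaleA a b x :
  quotmod_scale a (quotmod_scale b x) = quotmod_scale (a * b) x.
Proof. by rewrite -[x]quotmod_piK -!quotmod_piZ scalerA. Qed.

Lemma quotmod_scale1 : left_id 1 quotmod_scale.
Proof. by move=> x; rewrite -[x]quotmod_piK -quotmod_piZ scale1r. Qed.

Lemma quotmod_scaleDr : right_distributive quotmod_scale +%R.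
Proof.
move=> a x y; rewrite -[x]quotmod_piK -[y]quotmod_piK.
by rewrite -quotmod_piD -!quotmod_piZ scalerDr quotmod_piD.
Qed.

Lemma quotmod_scaleDl x : {morph quotmod_scale^~ x : a b / a + b}.
Proof.
move=> a b; rewrite -[x]quotmod_piK.
by rewrite -!quotmod_piZ scalerDl quotmod_piD.
Qed.

HB.instance Definition _ := GRing.Zmodule_isLmodule.Build R quotmod
  quotmod_scaleA quotmod_scale1 quotmod_scaleDr quotmod_scaleDl.

Lemma quotmod_pi_is_linear : linear quotmod_pi.
Proof. by move=> a u v; rewrite quotmod_piD quotmod_piZ. Qed.

HB.instance Definition _ :=
  GRing.isLinear.Build R V quotmod _ quotmod_pi quotmod_pi_is_linear.

End QuotientModule.

Section LinearImage.
Variables (R : pzRingType) (U V : lmodType R) (f : {linear U -> V}).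

Definition linear_image : {pred V} := fun v => `[< exists u : U, f u = v >].

Lemma linear_image_submod : submod_closed linear_image.
Proof.
split=> [|a u v]; first by apply/asboolP; exists 0; rewrite linear0.
move=> /asboolP[x <-] /asboolP[y <-].
by apply/asboolP; exists (a *: x + y); rewrite linearP.
Qed.

HB.instance Definition _ :=
  GRing.isSubmodClosed.Build R V linear_image linear_image_submod.

End LinearImage.

(* The type depends on phi only through the instances declared below. *)
Definition restrict_scalars (R S : pzRingType) (phi : {rmorphism R -> S})
  (V : lmodType S) : Type := V.

Section RestrictionOfScalars.
Variables (R S : pzRingType) (phi : {rmorphism R -> S}) (V : lmodType S).

Local Notation W := (restrict_scalars phi V).

HB.instance Definition _ := GRing.Zmodule.copy W V.

Definition restrict_scale (a : R) (v : W) : W :=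
  phi a *: (v : V).

Lemma restrict_scaleA a b v :
  restrict_scale a (restrict_scale b v) = restrict_scale (a * b) v.
Proof. by rewrite /restrict_scale scalerA rmorphM. Qed.

Lemma restrict_scale1 : left_id 1 restrict_scale.
Proof. by move=> v; rewrite /restrict_scale rmorph1 scale1r. Qed.

Lemma restrict_scaleDr : right_distributive restrict_scale +%R.
Proof. by move=> a u v; rewrite /restrict_scale scalerDr. Qed.

Lemma restrict_scaleDl v : {morph restrict_scale^~ v : a b / a + b}.
Proof. by move=> a b; rewrite /restrict_scale rmorphD scalerDl. Qed.

HB.instance Definition _ := GRing.Zmodule_isLmodule.Build R W
  restrict_scaleA restrict_scale1 restrict_scaleDr restrict_scaleDl.

End RestrictionOfScalars.

Section DependentProduct.
Variables (I : finType) (V : I -> zmodType).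

Definition dprodz : Type := {dffun forall i : I, V i}.

HB.instance Definition _ := Choice.on dprodz.

Implicit Types f g h : dprodz.

Definition dprodz_zero : dprodz := [ffun i => 0 : V i].
Definition dprodz_opp f : dprodz := [ffun i => - f i].
Definition dprodz_add f g : dprodz := [ffun i => f i + g i].

Lemma dprodz_addA : associative dprodz_add.
Proof. by move=> f g h; apply/ffunP=> i; rewrite !ffunE addrA. Qed.

Lemma dprodz_addC : commutative dprodz_add.
Proof. by move=> f g; apply/ffunP=> i; rewrite !ffunE addrC. Qed.

Lemma dprodz_add0 : left_id dprodz_zero dprodz_add.
Proof. by move=> f; apply/ffunP=> i; rewrite !ffunE add0r. Qed.

Lemma dprodz_addN : left_inverse dprodz_zero dprodz_opp dprodz_add.
Proof. by move=> f; apply/ffunP=> i; rewrite !ffunE addNr. Qed.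

HB.instance Definition _ := GRing.isZmodule.Build dprodz
  dprodz_addA dprodz_addC dprodz_add0 dprodz_addN.

End DependentProduct.

Section DirectSum.
Variables (R : pzRingType) (I : finType) (V : I -> lmodType R).

(* The index type is finite, so that the direct sum consists of all families. *)
Definition direct_sum : Type := dprodz V.

HB.instance Definition _ := GRing.Zmodule.on direct_sum.

Definition direct_sum_scale (a : R) (f : direct_sum) : direct_sum :=
  [ffun i => a *: f i].

Lemma direct_sum_scaleA a b f :
  direct_sum_scale a (direct_sum_scale b f) = direct_sum_scale (a * b) f.
Proof. by apply/ffunP=> i; rewrite !ffunE scalerA. Qed.

Lemma direct_sum_scale1 : left_id 1 direct_sum_scale.
Proof. by move=> f; apply/ffunP=> i; rewrite !ffunE scale1r. Qed.

Lemma direct_sum_scaleDr : right_distributive direct_sum_scale +%R.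
Proof. by move=> a f g; apply/ffunP=> i; rewrite !ffunE scalerDr. Qed.

Lemma direct_sum_scaleDl f : {morph direct_sum_scale^~ f : a b / a + b}.
Proof. by move=> a b; apply/ffunP=> i; rewrite !ffunE scalerDl. Qed.

HB.instance Definition _ := GRing.Zmodule_isLmodule.Build R direct_sum
  direct_sum_scaleA direct_sum_scale1 direct_sum_scaleDr direct_sum_scaleDl.

End DirectSum.

Section ProductOfFields.
(* There is at least one factor: polynomials need a nonzero coefficient ring. *)
Variables (s : nat) (K : 'I_s.+1 -> fieldType).

Definition prod_fields : Type := dprodz K.

HB.instance Definition _ := GRing.Zmodule.on prod_fields.

Implicit Types f g h : prod_fields.

Definition prod_fields_one : prod_fields := [ffun i => 1 : K i].
Definition prod_fields_mul f g : prod_fields := [ffun i => f i * g i].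

Lemma prod_fields_mulA : associative prod_fields_mul.
Proof. by move=> f g h; apply/ffunP=> i; rewrite !ffunE mulrA. Qed.

Lemma prod_fields_mulC : commutative prod_fields_mul.
Proof. by move=> f g; apply/ffunP=> i; rewrite !ffunE mulrC. Qed.

Lemma prod_fields_mul1 : left_id prod_fields_one prod_fields_mul.
Proof. by move=> f; apply/ffunP=> i; rewrite !ffunE mul1r. Qed.

Lemma prod_fields_mulDl : left_distributive prod_fields_mul +%R.
Proof. by move=> f g h; apply/ffunP=> i; rewrite !ffunE mulrDl. Qed.

Lemma prod_fields_one_neq0 : prod_fields_one != 0.
Proof.
apply/eqP=> /ffunP/(_ ord0); rewrite !ffunE => /eqP.
by rewrite oner_eq0.
Qed.

HB.instance Definition _ := GRing.Zmodule_isComNzRing.Build prod_fields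
  prod_fields_mulA prod_fields_mulC prod_fields_mul1 prod_fields_mulDl
  prod_fields_one_neq0.

Definition proj (i : 'I_s.+1) (f : prod_fields) : K i := f i.

Lemma proj_is_zmod_morphism i : zmod_morphism (proj i).
Proof. by move=> f g; rewrite /proj !ffunE. Qed.

Lemma proj_is_monoid_morphism i : monoid_morphism (proj i).
Proof. by split=> [|f g]; rewrite /proj !ffunE. Qed.

HB.instance Definition _ i :=
  GRing.isZmodMorphism.Build prod_fields (K i) (proj i)
    (proj_is_zmod_morphism i).
HB.instance Definition _ i :=
  GRing.isMonoidMorphism.Build prod_fields (K i) (proj i)
    (proj_is_monoid_morphism i).

End ProductOfFields.

Section Kernels.
Variables (T : comNzRingType) (p q1 q2 : nat).
Variables (A : 'M[{poly T}]_(p, q1)) (B : 'M[{poly T}]_(p, q2)).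

Definition in_ker_bar : {pred 'cV[{poly T}]_q2} :=
  fun u => `[< exists x : 'cV[{poly T}]_q1, A *m x + B *m u = 0 >].

Definition in_ker_pair : {pred 'cV[{poly T}]_q1 * 'cV[{poly T}]_q2} :=
  fun w => A *m w.1 + B *m w.2 == 0.

Definition in_ker : {pred 'cV[{poly T}]_q1} := fun x => A *m x == 0.

Lemma in_ker_bar_submod : submod_closed in_ker_bar.
Proof.
split=> [|a u v]; first by apply/asboolP; exists 0; rewrite !mulmx0 addr0.
move=> /asboolP[x xu] /asboolP[y yv]; apply/asboolP; exists (a *: x + y).
by rewrite !mulmxDr -!scalemxAr addrACA -scalerDr xu yv scaler0 addr0.
Qed.

Lemma in_ker_pair_submod : submod_closed in_ker_pair.
Proof.
split=> [|a v w]; first by rewrite unfold_in /= !mulmx0 addr0.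
rewrite !unfold_in /= => /eqP v0 /eqP w0.
by rewrite !mulmxDr -!scalemxAr addrACA -scalerDr v0 w0 scaler0 addr0.
Qed.

Lemma in_ker_submod : submod_closed in_ker.
Proof.
split=> [|a x y]; first by rewrite unfold_in mulmx0.
rewrite !unfold_in => /eqP x0 /eqP y0.
by rewrite mulmxDr -scalemxAr x0 y0 scaler0 addr0.
Qed.

HB.instance Definition _ :=
  GRing.isSubmodClosed.Build _ _ in_ker_bar in_ker_bar_submod.
HB.instance Definition _ :=
  GRing.isSubmodClosed.Build _ _ in_ker_pair in_ker_pair_submod.
HB.instance Definition _ :=
  GRing.isSubmodClosed.Build _ _ in_ker in_ker_submod.

(* ker(A | B), ker(A, B) and ker(A) as modules over {poly T} *)
Definition ker_bar : lmodType {poly T} := submodule in_ker_bar.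
Definition ker_pair : lmodType {poly T} := submodule in_ker_pair.
Definition ker : lmodType {poly T} := submodule in_ker.

Lemma ker_incl_subproof (x : ker) : (val x, 0) \in in_ker_pair.
Proof. by rewrite unfold_in /= mulmx0 addr0; exact: (valP x). Qed.

Definition ker_incl (x : ker) : ker_pair := Submodule (ker_incl_subproof x).

Lemma ker_incl_is_linear : linear ker_incl.
Proof.
move=> a x y; apply: val_inj; rewrite linearP /=.
by rewrite -[RHS]/(a *: val x + val y, a *: 0 + 0) scaler0 addr0.
Qed.

HB.instance Definition _ :=
  GRing.isLinear.Build {poly T} ker ker_pair _ ker_incl ker_incl_is_linear.

Definition ker_quot : lmodType {poly T} := quotmod (linear_image ker_incl).

End Kernels.

(* Main.v *)
From HB Require Import structures.
Require Import Defs.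
From mathcomp Require Import all_boot all_order all_algebra.
From mathcomp Require Import boolp.

(** The statement combines two independent facts.

    Over any commutative ring, (x, u) |-> u maps ker(A, B) onto ker(A | B)
    and its kernel is ker(A), so ker(A | B) is isomorphic to the quotient
    ker(A, B) / ker(A) ([ker_quot_pi_eq] and [ker_bar_class], which runs this
    isomorphism backwards: u |-> the class of any (x, u)).

    Over the product R of the fields, polynomials, hence matrices of
    polynomials, are the same thing as families of polynomials or matrices over
    the factors: they are determined by their projections ([glue_mx_unique]) and
    every family is glued from one ([glue_mxK]).  Solving A x + B u = 0 over R
    is therefore solving it over every factor separately, so that ker(A | B)
    is the direct sum of the kernels ker(pi_i A | pi_i B).

    The isomorphism sends u to the family of the classes of pi_i(u).  A
    preimage of a family of classes is the gluing of the second components of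
    representatives; the gluing of the first components witnesses that it lies
    in ker(A | B). *)

Import GRing.Theory.
Local Open Scope ring_scope.

(** * Linear maps into restricted modules and direct sums *)

Section RestrictLinear.
Context {R S : pzRingType} (phi : {rmorphism R -> S}) {V W : lmodType S}.
Variable f : {linear V -> W}.

Definition restrict_linear (v : restrict_scalars phi V) :
  restrict_scalars phi W := f v.

Lemma restrict_linear_is_linear : linear restrict_linear.
Proof. by move=> a u v; exact: (linearP f (phi a) u v). Qed.

HB.instance Definition _ := GRing.isLinear.Build R (restrict_scalars phi V)
  (restrict_scalars phi W) _ restrict_linear restrict_linear_is_linear.

End RestrictLinear.

Section DirectSumLift.
Context {R : pzRingType} {I : finType} {U : lmodType R} {V : I -> lmodType R}.
Variable (f : forall i, {linear U -> V i}).

Definition direct_sum_lift (u : U) : direct_sum V := [ffun i => f i u].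

Lemma direct_sum_lift_is_linear : linear direct_sum_lift.
Proof. by move=> a u v; apply/ffunP => i; rewrite !ffunE linearP. Qed.

HB.instance Definition _ := GRing.isLinear.Build R U (direct_sum V) _
  direct_sum_lift direct_sum_lift_is_linear.

End DirectSumLift.

(** * The isomorphism between ker(A | B) and ker(A, B) / ker(A) *)

Section KerBarClass.
Context {T : comNzRingType} {p q1 q2 : nat}.
Variables (A : 'M[{poly T}]_(p, q1)) (B : 'M[{poly T}]_(p, q2)).

Definition ker_quot_pi (w : ker_pair A B) : ker_quot A B :=
  quotmod_pi (linear_image (ker_incl (A := A) B)) w.

Definition ker_quot_repr (c : ker_quot A B) : ker_pair A B :=
  repr (c : Quotient.quot (submod_pred (linear_image (ker_incl (A := A) B)))).

Lemma ker_quot_reprK (c : ker_quot A B) : ker_quot_pi (ker_quot_repr c) = c.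
Proof. exact: quotmod_piK. Qed.

(** The kernel of (x, u) |-> u is ker(A): if (x, 0) is in ker(A, B), then
    A x = 0. *)
Lemma ker_quot_pi_eq (w w' : ker_pair A B) :
  (ker_quot_pi w = ker_quot_pi w') <-> ((val w).2 = (val w').2).
Proof.
split=> [/eqP|eq2].
  rewrite quotmod_pi_eq => /asboolP[x /(congr1 val)].
  rewrite raddfB => /(congr1 snd)/esym/eqP.
  by rewrite subr_eq0 => /eqP.
apply/eqP; rewrite quotmod_pi_eq; apply/asboolP.
have Ax0 : (val w).1 - (val w').1 \in in_ker A.
  have := valP w; have := valP w'.
  rewrite !unfold_in eq2 addr_eq0 => /eqP w'0 /eqP/addr0_eq w0.
  by rewrite mulmxBr w'0 -w0 opprK addrN.
exists (Submodule Ax0); apply: val_inj; rewrite raddfB.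
by rewrite -[RHS]/(_ , (val w).2 - (val w').2) eq2 subrr.
Qed.

Definition ker_bar_witness (u : ker_bar A B) : 'cV[{poly T}]_q1 :=
  projT1 (cid (asboolW (valP u))).

Lemma ker_bar_witnessP (u : ker_bar A B) :
  (ker_bar_witness u, val u) \in in_ker_pair A B.
Proof. by rewrite unfold_in /ker_bar_witness; case: cid => x /= ->. Qed.

Definition ker_bar_class (u : ker_bar A B) : ker_quot A B :=
  ker_quot_pi (Submodule (ker_bar_witnessP u)).

Lemma ker_bar_classE (u : ker_bar A B) (w : ker_pair A B) :
  (ker_bar_class u = ker_quot_pi w) <-> (val u = (val w).2).
Proof. exact: ker_quot_pi_eq. Qed.

(** The chosen witnesses do not depend linearly on u, but the class of (x, u)
    does not depend on the witness x. *)
Lemma ker_bar_class_is_linear : linear ker_bar_class.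
Proof.
move=> a u v.
rewrite {2 3}/ker_bar_class /ker_quot_pi -linearP.
by apply/ker_bar_classE; rewrite linearP.
Qed.

HB.instance Definition _ := GRing.isLinear.Build {poly T} (ker_bar A B)
  (ker_quot A B) _ ker_bar_class ker_bar_class_is_linear.

End KerBarClass.

(** * Change of the coefficient ring *)

Section KerBarMap.
Context {T T' : comNzRingType} {p q1 q2 : nat} (phi : {rmorphism T -> T'}).
Variables (A : 'M[{poly T}]_(p, q1)) (B : 'M[{poly T}]_(p, q2)).

Local Notation "M ^phi" := (map_mx (map_poly phi) M)
  (at level 2, format "M ^phi").

Lemma ker_bar_map_subproof (u : ker_bar A B) :
  (val u)^phi \in in_ker_bar A^phi B^phi.
Proof.
have /asboolP[x Axu] := valP u; apply/asboolP; exists x^phi.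
by rewrite -!map_mxM -map_mxD Axu map_mx0.
Qed.

Definition ker_bar_map (u : ker_bar A B) :
    restrict_scalars (map_poly phi) (ker_bar A^phi B^phi) :=
  Submodule (ker_bar_map_subproof u).

Lemma ker_bar_map_is_linear : linear ker_bar_map.
Proof.
move=> a u v; apply: val_inj.
rewrite -[RHS]/(map_poly phi a *: (val u)^phi + (val v)^phi).
by rewrite -map_mxZ -map_mxD.
Qed.

HB.instance Definition _ := GRing.isLinear.Build {poly T} (ker_bar A B)
  (restrict_scalars (map_poly phi) (ker_bar A^phi B^phi)) _
  ker_bar_map ker_bar_map_is_linear.

End KerBarMap.

(** * Polynomials over a product of fields *)

Section Glue.
Context {s : nat} {K : 'I_s.+1 -> fieldType}.

(** The coefficients of a polynomial over the product are families; only
    finitely many are nonzero because there are finitely many factors. *)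
Definition glue_poly (P : forall i, {poly K i}) : {poly prod_fields K} :=
  \poly_(k < \max_i size (P i)) ([ffun i => (P i)`_k] : prod_fields K).

Lemma glue_polyK (P : forall i, {poly K i}) i :
  map_poly (proj i) (glue_poly P) = P i.
Proof.
apply/polyP => k; rewrite coef_map coef_poly.
case: ifP => [_|/negbT]; first by rewrite /= /proj ffunE.
rewrite -leqNgt raddf0 => le_k; rewrite nth_default //.
exact: leq_trans (leq_bigmax i) le_k.
Qed.

Lemma glue_poly_unique (P Q : {poly prod_fields K}) :
  (forall i, map_poly (proj i) P = map_poly (proj i) Q) -> P = Q.
Proof.
move=> eqPQ; apply/polyP => k; apply/ffunP => i.
by have /polyP/(_ k) := eqPQ i; rewrite !coef_map.
Qed.

Definition glue_mx {m n} (M : forall i, 'M[{poly K i}]_(m, n)) :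
    'M[{poly prod_fields K}]_(m, n) :=
  \matrix_(j, k) glue_poly (fun i => M i j k).

Lemma glue_mxK m n (M : forall i, 'M[{poly K i}]_(m, n)) i :
  map_mx (map_poly (proj i)) (glue_mx M) = M i.
Proof. by apply/matrixP => j k; rewrite !mxE glue_polyK. Qed.

Lemma glue_mx_unique m n (M N : 'M[{poly prod_fields K}]_(m, n)) :
  (forall i, map_mx (map_poly (proj i)) M = map_mx (map_poly (proj i)) N) ->
  M = N.
Proof.
move=> eqMN; apply/matrixP => j k; apply: glue_poly_unique => i.
by have /matrixP/(_ j k) := eqMN i; rewrite !mxE.
Qed.

End Glue.

(** * Splitting ker(A | B) into its projections *)

Section Split.
Context {s : nat} {K : 'I_s.+1 -> fieldType} {p q1 q2 : nat}.
Variables (A : 'M[{poly prod_fields K}]_(p, q1)).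
Variables (B : 'M[{poly prod_fields K}]_(p, q2)).

Local Notation pi_ i M := (map_mx (map_poly (proj i)) M).

Local Notation ker_quot_sum := (direct_sum (fun i : 'I_s.+1 =>
  restrict_scalars (map_poly (proj i)) (ker_quot (pi_ i A) (pi_ i B)))).

Definition ker_bar_split : {linear ker_bar A B -> ker_quot_sum} :=
  direct_sum_lift (fun i =>
    restrict_linear (map_poly (proj i)) (ker_bar_class (pi_ i A) (pi_ i B))
      \o ker_bar_map (proj i) A B).

(** Since a class is determined by its second component, whether u is sent to d
    depends only on the projections of u; both halves of bijectivity thereby
    become statements about gluing. *)
Lemma ker_bar_split_eq (u : ker_bar A B) (d : ker_quot_sum) :
  (ker_bar_split u = d) <->
  (forall i, pi_ i (val u) = (val (ker_quot_repr _ _ (d i))).2).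
Proof.
split=> [/ffunP eq_ud i | eq_ud].
  apply: (iffLR (ker_bar_classE _ _ (ker_bar_map (proj i) A B u) _)).
  by rewrite ker_quot_reprK -eq_ud ffunE.
apply/ffunP => i; rewrite ffunE -[RHS]ker_quot_reprK.
exact: (iffRL (ker_bar_classE _ _ (ker_bar_map (proj i) A B u) _) (eq_ud i)).
Qed.

(** The equation A x + B u = 0 holds as soon as all its projections do, so the
    first components of the pairs glue to a witness for the second ones. *)
Lemma glue_ker_pair (w : forall i, ker_pair (pi_ i A) (pi_ i B)) :
  glue_mx (fun i => (val (w i)).2) \in in_ker_bar A B.
Proof.
apply/asboolP; exists (glue_mx (fun i => (val (w i)).1)).
apply: glue_mx_unique => i.
by rewrite map_mxD !map_mxM map_mx0 !glue_mxK; exact/eqP/(valP (w i)).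
Qed.

Definition ker_bar_glue (d : ker_quot_sum) : ker_bar A B :=
  Submodule (glue_ker_pair (fun i => ker_quot_repr _ _ (d i))).

End Split.

Theorem corollary5p5 (s : nat) (K : 'I_s.+1 -> fieldType) (p q1 q2 : nat)
    (A : 'M[{poly (prod_fields K)}]_(p, q1))
    (B : 'M[{poly (prod_fields K)}]_(p, q2)) :
  exists f : {linear ker_bar A B -> direct_sum (fun i : 'I_s.+1 =>
                restrict_scalars (map_poly (proj i))
                  (ker_quot (map_mx (map_poly (proj i)) A)
                            (map_mx (map_poly (proj i)) B)))},
    bijective f.
Proof.
exists (ker_bar_split A B).
exists (ker_bar_glue A B) => [u | d].
  apply: val_inj; apply: glue_mx_unique => i; rewrite /= glue_mxK.
  by have /ker_bar_split_eq-> := erefl (ker_bar_split A B u).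
by apply/ker_bar_split_eq => i; exact: glue_mxK.
Qed.
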